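(* Let $\mathcal{I}$ be an atomless ideal on a set $X$. Then $h\pi(P(X)/\mathcal{I})\geq \operatorname{add}(\mathcal{I})$; that is, for every $A\in\mathcal{I}^+$, every dense subset of the Boolean algebra $P(X)/(\mathcal{I}\upharpoonright A)$ has cardinality at least $\operatorname{add}(\mathcal{I})$.
   Context: An ideal on a set $X$ is a family $\mathcal{I}\subseteq P(X)$ such that (i) if $A_0,A_1\in\mathcal{I}$ and $A\subseteq A_0\cup A_1$ then $A\in\mathcal{I}$; (ii) $X\notin\mathcal{I}$ and $\{x\}\in\mathcal{I}$ for every $x\in X$. Write $\mathcal{I}^+=P(X)\setminus\mathcal{I}$ (the $\mathcal{I}$-positive sets). $\mathcal{I}$ is $\kappa$-complete if the union of any fewer than $\kappa$ members of $\mathcal{I}$ is in $\mathcal{I}$; $\operatorname{add}(\mathcal{I})$ is the least $\kappa$ such that $\mathcal{I}$ is not $\kappa$-complete. $P(X)/\mathcal{I}$ is the quotient Boolean algebra with $[A]\leq[B]$ iff $A\setminus B\in\mathcal{I}$. $\mathcal{I}$ is atomless if $P(X)/\mathcal{I}$ is an atomless Boolean algebra. For $A\in\mathcal{I}^+$, the restriction is $\mathcal{I}\upharpoonright A=\{B\subseteq X: B\cap A\in\mathcal{I}\}$. For a Boolean algebra $\mathbb{B}$, $\mathbb{B}^+=\mathbb{B}\setminus\{0\}$; $D\subseteq\mathbb{B}^+$ is dense if every $b\in\mathbb{B}^+$ has some $d\in D$ with $d\leq b$; $\pi(\mathbb{B})$ is the least cardinality of a dense subset; and $h\pi(\mathbb{B})=\min\{\pi(\{b\in\mathbb{B}: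 b\leq a\}): a\in\mathbb{B}^+\}$. For $\mathbb{B}=P(X)/\mathcal{I}$ this equals $\min\{\pi(P(X)/(\mathcal{I}\upharpoonright A)): A\in\mathcal{I}^+\}$.
   Formalization: Here add(I) is the least size of a subfamily of I whose union is not in I; the literal ''least κ such that I is not κ-complete'' would be its successor, for which the claim fails (an ideal on ω whose quotient is the Cohen algebra). *)

(* Defs.v *)
Set Implicit Arguments.

Definition pset (X : Type) := X -> Prop.

Definition is_ideal (X : Type) (I : pset X -> Prop) : Prop :=
  (forall A0 A1 A : pset X, I A0 -> I A1 ->
     (forall x, A x -> A0 x \/ A1 x) -> I A) /\
  ~ I (fun _ => True) /\
  (forall x : X, I (fun y => y = x)).

(* [A] <= [B] in P(X)/I  iff  A \ B in I *)
Definition qle (X : Type) (I : pset X -> Prop) (A B : pset X) : Prop :=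
  I (fun x => A x /\ ~ B x).

Definition is_atom (X : Type) (I : pset X -> Prop) (A : pset X) : Prop :=
  ~ I A /\ forall C : pset X, qle I C A -> I C \/ qle I A C.

Definition atomless (X : Type) (I : pset X -> Prop) : Prop :=
  forall A : pset X, ~ is_atom I A.

Definition restrict (X : Type) (I : pset X -> Prop) (A : pset X) : pset X -> Prop :=
  fun B => I (fun x => B x /\ A x).

Definition qclass (X : Type) (I : pset X -> Prop) (B : pset X) : pset X -> Prop :=
  fun C => I (fun x => (B x /\ ~ C x) \/ (C x /\ ~ B x)).

Definition dense_in (X : Type) (I : pset X -> Prop)
  (D : (pset X -> Prop) -> Prop) : Prop :=
  (forall d, D d -> exists B, ~ I B /\ d = qclass I B) /\
  (forall B : pset X, ~ I B ->
     exists d B', D d /\ d = qclass I B' /\ qle I B' B).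

(* |D| >= add(I): there is a family of members of I, indexed by a set J
   that injects into D, whose union is not in I. *)
Definition card_ge_add (X : Type) (I : pset X -> Prop)
  (D : (pset X -> Prop) -> Prop) : Prop :=
  exists (J : Type) (f : J -> pset X) (g : J -> (pset X -> Prop)),
    (forall j, I (f j)) /\
    ~ I (fun x => exists j, f j x) /\
    (forall j, D (g j)) /\
    (forall j1 j2, g j1 = g j2 -> j1 = j2).

(* Main.v *)
(** Suppose that D is dense and that unions of |D| null sets are null.  Pushing the ideal
    forward to the cardinal S = add(I), we get an ideal on S closed under unions of fewer
    than |S| sets, with bounded sets null, which still has a dense family (B_d) indexed by D.
    Let the B_d generate a topology on S.  Every map S -> P(D) is almost everywhere equal to
    a continuous one.  By an argument of Lusin, every positive subset of S has a nonmeager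
    bounded part; and a bounded set carries no S-sequence of nonmeager subsets with pairwise
    nowhere dense intersections.  So for each g : S -> P(D) and b in S there are fewer than |S|
    continuous maps such that any continuous G agreeing with g on a nonmeager part of b
    agrees with one of them on a non-nowhere-dense set, hence almost everywhere on some B_d.
    Define g recursively, g(s) avoiding the values at s of the maps attached to all b < s;
    this is possible because atomlessness keeps P(D) from being a union of fewer than |S|
    points: the fibers of x |-> {d | B_d x} are null.  Such a g is not almost everywhere
    equal to any continuous map, a contradiction. *)

Require Import Defs.
From mathcomp Require Import ssreflect ssrbool eqtype boolp wochoice.
From Stdlib Require Import Classical IndefiniteDescription FunctionalExtensionality
  PropExtensionality ProofIrrelevance Wellfounded.

Set Implicit Arguments.
Unset Strict Implicit.

(** * Ideals closed under unions indexed by [D] *)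

Record complete_ideal (X D : Type) (I : pset X -> Prop) : Prop := {
  ideal0 : I (fun _ => False);
  ideal_sub : forall P Q : pset X, I Q -> (forall x, P x -> Q x) -> I P;
  idealU : forall P Q : pset X, I P -> I Q -> I (fun x => P x \/ Q x);
  ideal_bigU : forall f : D -> pset X, (forall d, I (f d)) -> I (fun x => exists d, f d x) }.

Definition diff (X : Type) (P Q : pset X) : pset X := fun x => P x /\ ~ Q x.
Definition meet (X : Type) (P Q : pset X) : pset X := fun x => P x /\ Q x.

Section Ideal.
Context (X D : Type) (I : pset X -> Prop) (HI : complete_ideal D I).

Lemma positive_diff (P Q : pset X) : ~ I P -> I Q -> ~ I (diff P Q).
Proof.
intros HP HQ H; apply HP.
apply (ideal_sub HI) with (1 := idealU HI H HQ).
intros x Px; unfold diff; tauto.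
Qed.

Lemma positive_inhabited (P : pset X) : ~ I P -> exists x, P x.
Proof.
intros HP; apply NNPP; intros H; apply HP.
apply (ideal_sub HI) with (1 := ideal0 HI); intros x Px; apply H; now exists x.
Qed.

Lemma positive_bigU (f : D -> pset X) : ~ I (fun x => exists d, f d x) -> exists d, ~ I (f d).
Proof.
intros H; apply NNPP; intros H'; apply H, (ideal_bigU HI).
intros d; apply NNPP; intros Hd; apply H'; now exists d.
Qed.

Lemma positive_meet (P Q : pset X) : ~ I P -> I (diff P Q) -> ~ I (meet P Q).
Proof.
intros HP HPQ H; apply (positive_diff HP HPQ).
apply (ideal_sub HI) with (1 := H).
intros x [Px H']; split; trivial; apply NNPP; intros HQ; apply H'; now split.
Qed.

End Ideal.

(** * Well-orderings and recursion along them *)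

Lemma eqType_well_ordering (T : eqType) : exists lt : T -> T -> Prop,
  well_founded lt /\ (forall x y z, lt x y -> lt y z -> lt x z) /\
  (forall x y, lt x y \/ x = y \/ lt y x).
Proof.
(* [R] gives every nonempty predicate a unique least element. The order axioms come from sets of
   one, two or three points, well-foundedness from the set of inaccessible points. *)
have [R woR] := well_ordering_principle T.
have Rxx x : R x x.
  have [|z [[/eqP zx Rz] _]] := woR (pred1 x); first by exists x; apply/eqP.
  by rewrite zx in Rz; apply: Rz; apply/eqP.
have anti x y : R x y -> R y x -> x = y.
  move=> xy yx; have [|z [_ uz]] := woR (pred2 x y).
    by exists x; rewrite inE eqxx.
  have -> : x = z.
    symmetry; apply: uz; split; first by rewrite inE eqxx.
    by move=> t; rewrite inE => /orP[/eqP->|/eqP->].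
  apply: uz; split; first by rewrite inE eqxx orbT.
  by move=> t; rewrite inE => /orP[/eqP->|/eqP->].
have minP (P : T -> Prop) : (exists x, P x) -> exists z, P z /\ forall t, P t -> R z t.
  move=> [x Px]; have [|z [[Pz Rz] _]] := woR (fun t => `[<P t>]).
    by exists x; apply/asboolP.
  by exists z; split; [apply/asboolP | move=> t Pt; apply: Rz; apply/asboolP].
have tot x y : R x y \/ R y x.
  have [|z [[->|->] Rz]] := minP (fun t => t = x \/ t = y); first by exists x; left.
    by left; apply: Rz; right.
  by right; apply: Rz; left.
exists (fun x y => R x y /\ x <> y); split; [|split].
- move=> x; apply: contrapT => nx.
  have [|z [nz Rz]] := minP (fun t => ~ Acc (fun x y => R x y /\ x <> y) t); first by exists x.
  apply: nz; constructor => y [Ryz yz]; apply: contrapT => ny.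
  by apply: yz; apply: anti => //; apply: Rz.
- move=> x y z [xy nxy] [yz nyz].
  have [|m [mP Rm]] := minP (fun t => t = x \/ t = y \/ t = z); first by exists x; left.
  have Rmx : R m x by apply: Rm; left.
  have Rmy : R m y by apply: Rm; right; left.
  have Rmz : R m z by apply: Rm; right; right.
  case: mP => [mx|[my|mz]]; subst m.
  + by split=> // xz; subst z; apply: nxy; apply: anti.
  + by case: nxy; apply: anti.
  + by case: nyz; apply: anti.
- move=> x y; case: (pselect (x = y)) => [|nxy]; first by right; left.
  by case: (tot x y) => H; [left | right; right]; split=> // e; apply: nxy.
Qed.

Lemma well_ordering (T : Type) : exists lt : T -> T -> Prop,
  well_founded lt /\ (forall x y z, lt x y -> lt y z -> lt x z) /\
  (forall x y, lt x y \/ x = y \/ lt y x).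
Proof. exact (eqType_well_ordering {classic T}). Qed.

Lemma wf_choice (S T : Type) (lt : S -> S -> Prop) (P : S -> (S -> T) -> T -> Prop) :
  well_founded lt -> inhabited T ->
  (forall s h h' v, (forall t, lt t s -> h t = h' t) -> P s h v -> P s h' v) ->
  (forall s h, exists v, P s h v) ->
  exists g, forall s, P s g (g s).
Proof.
intros wf [v0] loc ex.
destruct (functional_choice (fun sh v => P (fst sh) (snd sh) v)) as [c Hc].
  intros [s h]; apply ex.
(* The history below [s] is padded to a total function by the default [v0]; [loc] makes [P] blind to
   the padding. *)
pose (ext := fun s (r : forall t, lt t s -> T) t =>
  match pselect (lt t s) with left p => r t p | right _ => v0 end).
pose (F := fun s r => c (s, ext s r)).
exists (Fix wf (fun _ => T) F); intros s.
rewrite Fix_eq.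
  apply (loc s (ext s (fun t _ => Fix wf (fun _ => T) F t))); [|apply (Hc (_, _))].
  intros t ts; unfold ext; destruct (pselect (lt t s)); tauto.
intros x f g fg; unfold F; f_equal; f_equal.
extensionality t; unfold ext; destruct (pselect (lt t x)); trivial.
Qed.

(** * Category and continuous maps on a well-ordered set with a dense family *)

Section Core.
Context (S D : Type) (I : pset S -> Prop) (HI : complete_ideal D I).
Context (lt : S -> S -> Prop) (lt_wf : well_founded lt).
Context (lt_trans : forall x y z, lt x y -> lt y z -> lt x z).
Context (lt_total : forall x y, lt x y \/ x = y \/ lt y x).
Context (I_segment : forall b (f : S -> pset S),
  (forall a, lt a b -> I (f a)) -> I (fun x => exists a, lt a b /\ f a x)).
Context (I_point : forall a, I (fun x => x = a)).
Context (S_positive : ~ I (fun _ => True)).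
Context (B : D -> pset S) (B_positive : forall d, ~ I (B d)).
Context (B_dense : forall P, ~ I P -> exists d, I (diff (B d) P)).
(** Relations that hold modulo [I] hold literally, as arranged by [disjointify]. The [B d] then form
    a base of a topology on their union, with all basic sets positive. *)
Context (B_disjoint : forall d e, I (meet (B d) (B e)) -> forall x, ~ meet (B d) (B e) x).
Context (B_subset : forall d e, I (diff (B e) (B d)) -> forall x, B e x -> B d x).

Definition nowhere_dense (T : pset S) :=
  forall d, exists e, (forall x, B e x -> B d x) /\ (forall x, B e x -> ~ T x).

(** Covers by [D]-many nowhere dense sets take the place of countable ones. *)
Definition meager (T : pset S) :=
  exists N : D -> pset S, (forall n, nowhere_dense (N n)) /\ (forall x, T x -> exists n, N n x).

(** The topology on P(D) is the one generated by the sets [{v | v i}]: membership of [i] is an open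
    condition, non-membership need not be. *)
Definition continuous (G : S -> D -> Prop) :=
  forall s i, G s i -> exists e, B e s /\ forall t, B e t -> G t i.

Lemma nowhere_dense_sub (P Q : pset S) :
  nowhere_dense Q -> (forall x, P x -> Q x) -> nowhere_dense P.
Proof.
intros HQ PQ d; destruct (HQ d) as [e [He1 He2]]; exists e; split; trivial.
intros x Bx Px; exact (He2 x Bx (PQ x Px)).
Qed.

Lemma positive_B_meet (d e : D) (x : S) : B d x -> B e x -> ~ I (meet (B d) (B e)).
Proof. intros Bd Be H; exact (B_disjoint H (conj Bd Be)). Qed.

Lemma B_refine (d e : D) (x : S) : B d x -> B e x ->
  exists c, (forall y, B c y -> B d y) /\ (forall y, B c y -> B e y).
Proof.
intros Bd Be; destruct (B_dense (positive_B_meet Bd Be)) as [c Hc].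
exists c; split; apply B_subset; apply (ideal_sub HI) with (1 := Hc);
  intros y [H1 H2]; split; trivial; intros [H3 H4]; tauto.
Qed.

(** For each [i], take the union of the [B e] almost contained in [{t | g t i}]. The excess is a
    union of [D]-many null sets; a positive remainder would almost contain some [B e], which is
    already in the union. *)
Lemma continuous_approx (g : S -> D -> Prop) :
  exists G, continuous G /\ I (fun s => G s <> g s).
Proof.
pose (G := fun s i => exists e, B e s /\ I (diff (B e) (fun t => g t i))).
exists G; split.
  intros s i [e [Bs He]]; exists e; split; trivial; intros t Bt; now exists e.
apply (ideal_sub HI) with (Q := fun s => exists i, diff (fun s => G s i) (fun s => g s i) s
                                         \/ diff (fun s => g s i) (fun s => G s i) s).
- apply (ideal_bigU HI); intros i; apply (idealU HI).
  + apply (ideal_sub HI) with (Q := fun s => exists e,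
      I (diff (B e) (fun t => g t i)) /\ diff (B e) (fun t => g t i) s).
      apply (ideal_bigU HI); intros e.
      destruct (classic (I (diff (B e) (fun t => g t i)))) as [H|H].
        apply (ideal_sub HI) with (1 := H); tauto.
      apply (ideal_sub HI) with (1 := ideal0 HI); tauto.
    intros s [[e [Bs He]] Hs]; exists e; repeat split; trivial.
  + apply NNPP; intros H; destruct (B_dense H) as [e He].
    apply (B_positive (d := e)); apply (ideal_sub HI) with (1 := He).
    intros s Bs; split; trivial; intros [_ Gs]; apply Gs; exists e; split; trivial.
    apply (ideal_sub HI) with (1 := He); intros t [Bt Ht]; split; trivial; now intros [gt _].
- intros s H; apply NNPP; intros H'; apply H; extensionality i.
  apply propositional_extensionality; split; intros Hi; apply NNPP; intros Hi';
    apply H'; exists i; [left | right]; now split.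
Qed.

(** Agreement is dense in some [B d]. If [i] were in [H] but not in [H'] on a positive part of
    [B d], some [B e] would lie almost inside that part; an agreement point in a smaller basic set
    would put [i] into [H'] on a basic neighbourhood, hence on a positive part of [B e]. *)
Lemma continuous_agree (G G' : S -> D -> Prop) :
  continuous G -> continuous G' -> ~ nowhere_dense (fun s => G s = G' s) ->
  exists d, I (fun s => B d s /\ G s <> G' s).
Proof.
assert (key : forall d H H', continuous H -> continuous H' ->
  (forall e, (forall x, B e x -> B d x) -> exists x, B e x /\ H x = H' x) ->
  forall i, I (fun s => B d s /\ diff (fun s => H s i) (fun s => H' s i) s)).
  intros d H H' cH cH' agree i; apply NNPP; intros pos.
  destruct (B_dense pos) as [e He].
  destruct (positive_inhabited HI (positive_meet HI (@B_positive e) He))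
    as [s [Bes [Bds [Hs _]]]].
  destruct (cH s i Hs) as [e1 [Be1s He1]].
  destruct (B_refine Bes Be1s) as [e2 [e2e e2e1]].
  assert (ed : forall x, B e x -> B d x).
    apply B_subset; apply (ideal_sub HI) with (1 := He).
    intros x [Hx Hx']; split; trivial; intros [Hx'' _]; tauto.
  destruct (agree e2) as [t [Be2t Ht]]; [auto|].
  assert (H't : H' t i) by (rewrite <- Ht; auto).
  destruct (cH' t i H't) as [e3 [Be3t He3]].
  apply (positive_B_meet Be2t Be3t), (ideal_sub HI) with (1 := He).
  intros x [Hx2 Hx3]; split; auto; intros [_ [_ Hx]]; auto.
intros cG cG' nnd.
apply not_all_ex_not in nnd; destruct nnd as [d Hd]; exists d.
assert (agree : forall e, (forall x, B e x -> B d x) -> exists x, B e x /\ G x = G' x).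
  intros e ed; apply NNPP; intros H; apply Hd; exists e; split; trivial.
  intros x Bx Gx; apply H; now exists x.
apply (ideal_sub HI) with (Q := fun s => exists i,
  (B d s /\ diff (fun s => G s i) (fun s => G' s i) s) \/
  (B d s /\ diff (fun s => G' s i) (fun s => G s i) s)).
- apply (ideal_bigU HI); intros i; apply (idealU HI); apply key; trivial.
  intros e ed; destruct (agree e ed) as [x [? ?]]; now exists x.
- intros s [Bs H]; apply NNPP; intros H'; apply H; extensionality i.
  apply propositional_extensionality; split; intros Hi; apply NNPP; intros Hi';
    apply H'; exists i; [left | right]; now repeat split.
Qed.

Lemma segment_null (b : S) : I (fun x => lt x b).
Proof.
apply (ideal_sub HI) with (1 := I_segment (f := fun a x => x = a) (b := b) (fun a _ => I_point a)).
intros x xb; now exists x.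
Qed.

Lemma not_above_null (b : S) : I (fun x => ~ lt b x).
Proof.
apply (ideal_sub HI) with (1 := idealU HI (segment_null b) (I_point b)).
intros x bx; destruct (lt_total x b) as [|[|]]; tauto.
Qed.

(** Otherwise nowhere dense sets [N b n] cover [P] below each [b]. For each [s] in [P] there are
    [p], [n] with [s] in [N b n] for almost every [b] in [B p]; a positive set of [s] shares one
    such pair. Choose [D]-many of these [s], dense in some [B d]: a single [b] has all of them in
    [N b n], which is then dense in [B d]. *)
Lemma nonmeager_segment (P : pset S) :
  ~ I P -> exists b, ~ meager (fun s => P s /\ lt s b).
Proof.
intros posP; apply NNPP; intros H.
destruct (functional_choice (fun b (N : D -> pset S) => (forall n, nowhere_dense (N n)) /\
  (forall x, P x /\ lt x b -> exists n, N n x))) as [N HN].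
  intros b; apply NNPP; intros Hb; apply H; exists b; exact Hb.
pose (Z := fun p n s => P s /\ I (diff (B p) (fun b => N b n s))).
destruct (positive_bigU HI (f := fun p s => exists n, Z p n s)) as [p posp].
  intros H'; apply posP, (ideal_sub HI) with (1 := H'); intros s Ps.
  destruct (positive_bigU HI (f := fun n b => lt s b /\ N b n s)) as [n Hn].
    intros H''; apply S_positive.
    apply (ideal_sub HI) with (1 := idealU HI H'' (not_above_null s)).
    intros b _; destruct (classic (lt s b)) as [sb|]; [left|tauto].
    destruct (proj2 (HN b) s (conj Ps sb)) as [n Hn]; now exists n.
  destruct (B_dense Hn) as [p Hp]; exists p, n; split; trivial.
  apply (ideal_sub HI) with (1 := Hp); intros b [Bb Nb]; split; trivial; now intros [_ ?].
destruct (positive_bigU HI posp) as [n posn].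
destruct (B_dense posn) as [d Hd].
(* One point of Z in every basic set below B_d: a dense set of at most |D| points. *)
destruct (functional_choice (fun e s => (forall x, B e x -> B d x) -> B e s /\ Z p n s))
  as [pt Hpt].
  intros e; destruct (classic (forall x, B e x -> B d x)) as [ed|ned].
    assert (He : I (diff (B e) (Z p n))).
      apply (ideal_sub HI) with (1 := Hd); intros x [Bx Zx]; split; auto.
    destruct (positive_inhabited HI (positive_meet HI (@B_positive e) He)) as [s [Bs Zs]].
    now exists s.
  destruct (positive_inhabited HI S_positive) as [s _]; exists s; tauto.
assert (Hnull : I (fun b => exists e, (forall x, B e x -> B d x) /\
                                      diff (B p) (fun b => N b n (pt e)) b)).
  apply (ideal_bigU HI); intros e; destruct (classic (forall x, B e x -> B d x)) as [ed|ned].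
    destruct (Hpt e ed) as [_ [_ H']]; apply (ideal_sub HI) with (1 := H'); tauto.
  apply (ideal_sub HI) with (1 := ideal0 HI); tauto.
destruct (positive_inhabited HI (positive_diff HI (@B_positive p) Hnull)) as [b [Bb Hb]].
destruct (proj1 (HN b) n d) as [e [ed He]].
destruct (Hpt e ed) as [Bpt _].
apply (He _ Bpt); apply NNPP; intros H'; apply Hb; exists e; split; trivial; now split.
Qed.

(* Membership of a in E_nu is, for almost every nu, decided by some B_p containing nu; being
   nonmeager, E_nu has a nonmeager piece that is decided by a single B_p and is therefore
   common to almost all E_nu' with nu' in B_p. *)
Lemma no_long_almost_disjoint_family (b : S) (E : S -> pset S) :
  (forall nu a, E nu a -> lt a b) -> (forall nu, ~ meager (E nu)) ->
  (forall nu nu', lt nu' nu -> nowhere_dense (meet (E nu) (E nu'))) -> False.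
Proof.
intros Eb nonmeag ad.
pose (hull := fun a nu => exists p, B p nu /\ I (diff (B p) (fun nu => E nu a))).
assert (Hhull : I (fun nu => exists a, lt a b /\ ~ (hull a nu <-> E nu a))).
  apply I_segment; intros a _.
  apply (ideal_sub HI) with (Q := fun nu => (exists p,
    I (diff (B p) (fun nu => E nu a)) /\ diff (B p) (fun nu => E nu a) nu) \/
    diff (fun nu => E nu a) (hull a) nu).
  - apply (idealU HI).
    + apply (ideal_bigU HI); intros p.
      destruct (classic (I (diff (B p) (fun nu => E nu a)))) as [H|H].
        apply (ideal_sub HI) with (1 := H); tauto.
      apply (ideal_sub HI) with (1 := ideal0 HI); tauto.
    + apply NNPP; intros H; destruct (B_dense H) as [p Hp].
      apply (B_positive (d := p)); apply (ideal_sub HI) with (1 := Hp).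
      intros nu Bnu; split; trivial; intros [_ Hnu]; apply Hnu; exists p; split; trivial.
      apply (ideal_sub HI) with (1 := Hp); intros t [Bt Ht]; split; trivial; now intros [? _].
  - intros nu H; destruct (classic (E nu a)) as [Ea|Ea].
      right; split; tauto.
    left; apply NNPP; intros H'; apply H; split; [|tauto].
    intros [p [Bp Hp]]; exfalso; apply H'; exists p; now repeat split.
pose (good := fun nu => forall a, lt a b -> (hull a nu <-> E nu a)).
assert (Hgood : I (fun nu => ~ good nu)).
  apply (ideal_sub HI) with (1 := Hhull); intros nu H; apply NNPP; intros H'; apply H.
  intros a ab; apply NNPP; intros H''; apply H'; now exists a.
destruct (positive_inhabited HI (positive_diff HI S_positive Hgood)) as [nu [_ gnu]].
apply NNPP in gnu.
pose (piece := fun p a => B p nu /\ lt a b /\ I (diff (B p) (fun nu => E nu a))).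
assert (exists p, ~ nowhere_dense (piece p)) as [p Hp].
  apply NNPP; intros H; apply (@nonmeag nu); exists piece; split.
    intros p; apply NNPP; intros H'; apply H; now exists p.
  intros a Ea; assert (ab := Eb nu a Ea); apply (gnu a ab) in Ea.
  destruct Ea as [p [Bp Hp]]; exists p; now repeat split.
assert (Bp : B p nu).
  apply NNPP; intros nB; apply Hp; intros d; exists d; split; trivial.
  intros x _ [Bp _]; tauto.
destruct (positive_inhabited HI (positive_diff HI (@B_positive p)
            (idealU HI Hgood (I_point nu)))) as [nu' [Bp' gnu']].
assert (sub : forall x, piece p x -> E nu x /\ E nu' x).
  intros x [_ [xb Hx]]; split; [apply (gnu x xb); now exists p|].
  assert (gn : good nu') by (apply NNPP; tauto).
  apply (gn x xb); now exists p.
apply Hp; destruct (lt_total nu nu') as [ltn|[eqn|ltn]].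
- apply (nowhere_dense_sub (ad _ _ ltn)); intros x Hx; destruct (sub x Hx); now split.
- exfalso; apply gnu'; right; auto.
- apply (nowhere_dense_sub (ad _ _ ltn)); intros x Hx; destruct (sub x Hx); now split.
Qed.

(** If no proper initial segment of [S] indexed such a family, recursion along all of [S] would
    contradict [no_long_almost_disjoint_family]. *)
Lemma maximal_family (g : S -> D -> Prop) (b : S) :
  exists (N : S) (fam : S -> S -> D -> Prop), (forall nu, continuous (fam nu)) /\
    forall G, continuous G -> ~ meager (fun t => lt t b /\ G t = g t) ->
    exists nu, lt nu N /\ ~ nowhere_dense (fun t => G t = fam nu t).
Proof.
apply NNPP; intros H.
pose (E := fun (G : S -> D -> Prop) t => lt t b /\ G t = g t).
assert (inhabited {G | continuous G}) as inh.
  constructor; exists (fun _ _ => False); intros s i [].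
destruct (@wf_choice S {G | continuous G} lt (fun nu h G => ~ meager (E (proj1_sig G)) /\
  forall nu', lt nu' nu -> nowhere_dense (meet (E (proj1_sig G)) (E (proj1_sig (h nu'))))))
  as [fam Hfam]; trivial.
- intros s h h' v hh' [H1 H2]; split; trivial.
  intros nu' lt'; rewrite <- hh'; auto.
- intros s h; apply NNPP; intros H'; apply H.
  exists s, (fun nu => proj1_sig (h nu)); split; [intros nu; apply proj2_sig|].
  intros G cG mG; apply NNPP; intros H''; apply H'.
  exists (exist _ G cG); split; trivial; simpl.
  intros nu' lt'; apply NNPP; intros nd; apply H''; exists nu'; split; trivial.
  intros nd'; apply nd, (nowhere_dense_sub nd').
  intros x [[_ H1] [_ H2]]; congruence.
- apply (@no_long_almost_disjoint_family b (fun nu => E (proj1_sig (fam nu)))).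
  + now intros nu a [].
  + intros nu; apply Hfam.
  + intros nu nu'; apply Hfam.
Qed.

Lemma values_exhausted :
  ~ (forall s (N : S -> S) (w : S -> S -> D -> Prop),
       exists v, forall b nu, lt b s -> lt nu (N b) -> v <> w b nu).
Proof.
intros avoid.
destruct (functional_choice (fun (gb : (S -> D -> Prop) * S) (p : S * (S -> S -> D -> Prop)) =>
  (forall nu, continuous (snd p nu)) /\
  forall G, continuous G -> ~ meager (fun t => lt t (snd gb) /\ G t = fst gb t) ->
  exists nu, lt nu (fst p) /\ ~ nowhere_dense (fun t => G t = snd p nu t))) as [M HM].
  intros [g b]; destruct (maximal_family g b) as [N [fam HN]]; now exists (N, fam).
(* [M] may depend on the whole map; truncating at [b] makes the attached family depend only on
   values below [b], as recursion requires, and leaves agreement below [b] unchanged. *)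
pose (trunc := fun b (h : S -> D -> Prop) t i => lt t b /\ h t i).
pose (N := fun h b => fst (M (trunc b h, b))).
pose (fam := fun h b => snd (M (trunc b h, b))).
destruct (@wf_choice S (D -> Prop) lt (fun s h v => forall b nu, lt b s -> lt nu (N h b) ->
  v <> fam h b nu s)) as [g Hg].
- exact lt_wf.
- constructor; exact (fun _ => False).
- intros s h h' v hh' H b nu bs.
  assert (trunc b h' = trunc b h) as e.
    extensionality t; extensionality i; apply propositional_extensionality.
    unfold trunc; split; intros [tb Ht]; split; trivial.
      rewrite hh'; trivial; exact (lt_trans tb bs).
    rewrite <- hh'; trivial; exact (lt_trans tb bs).
  unfold N, fam; rewrite e; apply H; trivial.
- intros s h; apply (avoid s (N h) (fun b nu => fam h b nu s)).
destruct (continuous_approx g) as [G [cG HG]].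
destruct (@nonmeager_segment (fun s => G s = g s)) as [b Hb].
  intros H; apply S_positive; apply (ideal_sub HI) with (1 := idealU HI HG H).
  intros x _; destruct (classic (G x = g x)); tauto.
destruct (HM (trunc b g, b)) as [cfam Hfam].
destruct (Hfam G cG) as [nu [nuN Hnu]].
  intros [Q [HQ1 HQ2]]; apply Hb; exists Q; split; trivial.
  intros x [Gx xb]; apply HQ2; simpl; split; trivial; rewrite Gx.
  extensionality i; apply propositional_extensionality; unfold trunc; tauto.
destruct (continuous_agree cG (cfam nu) Hnu) as [d Hd].
(* This [s] is in [B d], above [b] and off both error sets, so [g s] is a forbidden value. *)
destruct (positive_inhabited HI (positive_diff HI (@B_positive d)
  (idealU HI Hd (idealU HI HG (not_above_null b))))) as [s [Bs Hs]].
apply (Hg s b nu).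
- apply NNPP; tauto.
- exact nuN.
- transitivity (G s); [symmetry|]; apply NNPP; tauto.
Qed.

End Core.

(** All null meets and null differences of pairs lie in one null set [Z], by two nested unions over
    [D]; removing [Z] from every [B d] suffices. *)
Lemma disjointify (S D : Type) (I : pset S -> Prop) (HI : complete_ideal D I) (B : D -> pset S) :
  (forall d, ~ I (B d)) -> (forall P, ~ I P -> exists d, I (diff (B d) P)) ->
  exists B' : D -> pset S, (forall d, ~ I (B' d)) /\
    (forall P, ~ I P -> exists d, I (diff (B' d) P)) /\
    (forall d e, I (meet (B' d) (B' e)) -> forall x, ~ meet (B' d) (B' e) x) /\
    (forall d e, I (diff (B' e) (B' d)) -> forall x, B' e x -> B' d x).
Proof.
intros posB denseB.
pose (Z := fun x => exists d e, (I (meet (B d) (B e)) /\ meet (B d) (B e) x) \/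
                                (I (diff (B e) (B d)) /\ diff (B e) (B d) x)).
assert (cond : forall P : pset S, I (fun x => I P /\ P x)).
  intros P; destruct (classic (I P)) as [H|H].
    apply (ideal_sub HI) with (1 := H); tauto.
  apply (ideal_sub HI) with (1 := ideal0 HI); tauto.
assert (HZ : I Z).
  apply (ideal_bigU HI); intros d; apply (ideal_bigU HI); intros e.
  apply (idealU HI); apply cond.
exists (fun d => diff (B d) Z); repeat split.
- intros d; apply (positive_diff HI); trivial.
- intros P HP; destruct (denseB P HP) as [d Hd]; exists d.
  apply (ideal_sub HI) with (1 := Hd); intros x [[? _] ?]; now split.
- intros d e H x [[Bd nZ] [Be _]]; apply nZ; exists d, e; left; split; [|now split].
  apply (ideal_sub HI) with (1 := idealU HI HZ H); intros y [yd ye].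
  destruct (classic (Z y)); [now left | right; now repeat split].
- destruct H0 as [Be nZ]; apply NNPP; intros nBd; apply nZ; exists d, e; right.
  split; [|now split]; apply (ideal_sub HI) with (1 := idealU HI HZ H); intros y [ye yd].
  destruct (classic (Z y)); [now left | right; repeat split; trivial; now intros [? _]].
- now destruct H0.
Qed.

(** * Pushing an ideal and a dense family forward along a partial map *)

Section Pushforward.
Context (X D S : Type) (R : pset X -> Prop) (HR : complete_ideal D R).
Context (B : D -> pset X).
Context (B_dense : forall P, ~ R P -> exists d, ~ R (B d) /\ R (diff (B d) P)).
Context (F : S -> pset X) (F_disjoint : forall s t x, F s x -> F t x -> s = t).

(** The map is partial from [X] to [S], with fibre [F s] over [s]. *)
Definition preimage (E : pset S) : pset X := fun x => exists s, E s /\ F s x.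
Definition pushforward (E : pset S) : Prop := R (preimage E).

Lemma pushforward_ideal : complete_ideal D pushforward.
Proof.
split.
- apply (ideal_sub HR) with (1 := ideal0 HR); now intros x [s [[] _]].
- intros P Q HQ PQ; apply (ideal_sub HR) with (1 := HQ); intros x [s [Ps Fs]]; exists s; auto.
- intros P Q HP HQ; apply (ideal_sub HR) with (1 := idealU HR HP HQ).
  intros x [s [[Ps|Qs] Fs]]; [left | right]; exists s; auto.
- intros f Hf; apply (ideal_sub HR) with (1 := ideal_bigU HR Hf).
  intros x [s [[d fd] Fs]]; exists d, s; auto.
Qed.

(* The d-th set is the projection of B_d, the least E modulo null sets such that B_d is
   almost contained in the preimage of E. *)
Lemma pushforward_dense : ~ pushforward (fun _ => True) ->
  exists B' : D -> pset S, (forall d, ~ pushforward (B' d)) /\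
    forall P, ~ pushforward P -> exists d, pushforward (diff (B' d) P).
Proof.
intros Spos.
assert (HP := pushforward_ideal).
(* [W (d, e)] has preimage almost disjoint from [B d], and almost containing [B e] if any such set
   does. By density these [D]-many sets exhaust, modulo null sets, everything that almost misses
   [B d]; [proj d] is the complement of their union. *)
destruct (functional_choice (fun (de : D * D) E => R (meet (B (fst de)) (preimage E)) /\
  ((exists E, R (meet (B (fst de)) (preimage E)) /\ R (diff (B (snd de)) (preimage E))) ->
   R (diff (B (snd de)) (preimage E))))) as [W HW].
  intros [d e]; simpl.
  destruct (classic (exists E, R (meet (B d) (preimage E)) /\ R (diff (B e) (preimage E))))
    as [[E HE]|H].
    exists E; tauto.
  exists (fun _ => False); split; [|tauto].
  apply (ideal_sub HR) with (1 := ideal0 HR); now intros x [_ [s [[] _]]].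
pose (proj := fun d s => forall e, ~ W (d, e) s).
assert (outside : forall d E, R (meet (B d) (preimage E)) -> pushforward (meet E (proj d))).
  intros d E HE; apply NNPP; intros pos.
  destruct (B_dense pos) as [e [Be He]].
  destruct (HW (d, e)) as [_ HWe]; simpl in HWe.
  apply Be, (ideal_sub HR) with (1 := idealU HR He (HWe (ex_intro _ _ (conj
    (ideal_sub HR HE (fun x (H : meet (B d) (preimage (meet E (proj d))) x) => match H with
      conj Bx (ex_intro s (conj (conj Es _) Fs)) => conj Bx (ex_intro _ s (conj Es Fs)) end)) He)))).
  intros x Bx; destruct (classic (preimage (meet E (proj d)) x)) as [[s [[Es ps] Fs]]|];
    [right | now left].
  split; trivial; intros [t [Wt Ft]]; rewrite (F_disjoint Fs Ft) in ps; exact (ps e Wt).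
assert (inside : forall d P, ~ R (B d) -> R (diff (B d) (preimage P)) -> ~ pushforward (proj d)).
  intros d P Bd HP' H; apply Bd.
  assert (HWd : R (fun x => exists e, meet (B d) (preimage (W (d, e))) x)).
    apply (ideal_bigU HR); intros e; apply (HW (d, e)).
  apply (ideal_sub HR) with (1 := idealU HR HP' (idealU HR H HWd)); intros x Bx.
  destruct (classic (preimage P x)) as [[s [Ps Fs]]|]; [right | left; now split].
  destruct (classic (proj d s)) as [ps|ps]; [left; now exists s | right].
  apply not_all_ex_not in ps; destruct ps as [e He]; apply NNPP in He.
  exists e; split; trivial; now exists s.
(* A null projection, such as that of a null [B d], is replaced by all of [S] to make every member
   positive. *)
exists (fun d s => pushforward (proj d) \/ proj d s); split.
- intros d H; destruct (classic (pushforward (proj d))) as [H'|H'].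
    apply Spos, (ideal_sub HP) with (1 := H); tauto.
  apply H', (ideal_sub HP) with (1 := H); tauto.
- intros P Ppos; destruct (B_dense Ppos) as [d [Bd Hd]]; exists d.
  assert (pos := inside d P Bd Hd).
  apply (ideal_sub HP) with (Q := meet (fun s => ~ P s) (proj d)).
    apply outside, (ideal_sub HR) with (1 := Hd); intros x [Bx [s [nP Fs]]]; split; trivial.
    intros [t [Pt Ft]]; rewrite (F_disjoint Fs Ft) in nP; tauto.
  intros s [[?|?] ?]; [tauto | now split].
Qed.

End Pushforward.

(** * Transfer to the cardinal add(I), and the fibres of the membership map *)

Lemma positive_fiber (X D : Type) (R : pset X -> Prop) (HR : complete_ideal D R)
  (R_point : forall x, R (fun y => y = x)) (X_positive : ~ R (fun _ => True))
  (B : D -> pset X)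
  (B_dense : forall P, ~ R P -> exists d, ~ R (B d) /\ R (diff (B d) P)) :
  exists v : D -> Prop, ~ R (fun x => (fun d => B d x) = v).
Proof.
apply NNPP; intros H.
assert (fiber_null : forall v : D -> Prop, R (fun x => (fun d => B d x) = v)).
  intros v; apply NNPP; intros Hv; apply H; now exists v.
clear H.
destruct (well_ordering X) as [ltX [wfX [transX totalX]]].
pose (bad := fun seg : X -> Prop => exists f : X -> pset X,
  (forall a, seg a -> R (f a)) /\ ~ R (fun x => exists a, seg a /\ f a x)).
(* seg plays the role of the cardinal add(R): every proper initial segment indexes only
   null unions. *)
assert (exists seg, bad seg /\ (forall a b, ltX a b -> seg b -> seg a) /\
        forall b, seg b -> ~ bad (fun a => ltX a b)) as [seg [[f [fnull fpos]] [down nbad]]].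
  destruct (classic (exists b, bad (fun a => ltX a b))) as [[b Hb]|H].
    induction (wfX b) as [b _ IH].
    destruct (classic (exists c, ltX c b /\ bad (fun a => ltX a c))) as [[c [cb Hc]]|H].
      exact (IH c cb Hc).
    exists (fun a => ltX a b); split; [trivial|split].
      intros a c ac cb; exact (transX _ _ _ ac cb).
    intros c cb Hc; apply H; now exists c.
  (* If no proper segment is bad, all of [X] is, by its singletons. *)
  exists (fun _ => True); split; [|split; trivial].
    exists (fun a y => y = a); split; [auto|]; intros H'; apply X_positive.
    apply (ideal_sub HR) with (1 := H'); intros x _; now exists x.
  intros b _ Hb; apply H; now exists b.
pose (S := {a | seg a}).
pose (lt := fun a b : S => ltX (proj1_sig a) (proj1_sig b)).
(* [F s] keeps the points whose first index in [f] is [s]. *)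
pose (F := fun (s : S) x => f (proj1_sig s) x /\ forall t : S, lt t s -> ~ f (proj1_sig t) x).
assert (lift_eq : forall a b : S, proj1_sig a = proj1_sig b -> a = b).
  intros [a Ha] [b Hb]; simpl; intros e; subst b; f_equal; apply proof_irrelevance.
assert (lt_wf : well_founded lt) by exact (wf_inverse_image S X ltX (@proj1_sig _ _) wfX).
assert (lt_trans : forall x y z, lt x y -> lt y z -> lt x z).
  intros x y z; apply transX.
assert (lt_total : forall x y, lt x y \/ x = y \/ lt y x).
  intros x y; destruct (totalX (proj1_sig x) (proj1_sig y)) as [|[|]]; auto.
assert (F_disjoint : forall s t x, F s x -> F t x -> s = t).
  intros s t x [fs ns] [ft nt]; destruct (lt_total s t) as [st|[|ts]]; trivial; exfalso.
    exact (nt s st fs).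
  exact (ns t ts ft).
assert (R_segment : forall (b : S) (h : S -> pset X), (forall a, lt a b -> R (h a)) ->
                    R (fun x => exists a, lt a b /\ h a x)).
  intros [b Hb] h Hh; apply NNPP; intros H; apply (nbad b Hb).
  exists (fun a x => exists Ha : seg a, h (exist _ a Ha) x); split.
    intros a ab; pose (Ha := down a b ab Hb).
    apply (ideal_sub HR) with (1 := Hh (exist _ a Ha) ab); intros x [Ha' hx].
    now rewrite (proof_irrelevance _ Ha Ha').
  intros H'; apply H, (ideal_sub HR) with (1 := H'); intros x [[a Ha] [ab hx]].
  exists a; split; [exact ab | now exists Ha].
pose (I := pushforward R F).
assert (HI : complete_ideal D I) by (apply pushforward_ideal; exact HR).
assert (S_positive : ~ I (fun _ => True)).
  intros H; apply fpos, (ideal_sub HR) with (1 := H); intros x [a [Ha fa]].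
  assert (exists s : S, f (proj1_sig s) x) as [s fs] by now exists (exist _ a Ha).
  clear a Ha fa; induction (lt_wf s) as [s _ IH].
  destruct (classic (exists t, lt t s /\ f (proj1_sig t) x)) as [[t [ts ft]]|H'].
    exact (IH t ts ft).
  exists s; split; trivial; split; trivial; intros t ts ft; apply H'; now exists t.
destruct (pushforward_dense HR B_dense F_disjoint S_positive) as [B1 [B1pos B1dense]].
destruct (disjointify HI B1pos B1dense) as [B2 [B2pos [B2dense [B2disj B2sub]]]].
apply (values_exhausted HI lt_wf lt_trans lt_total) with (B := B2); trivial.
- intros b h Hh; apply (ideal_sub HR) with (1 := R_segment b (fun a => preimage F (h a)) Hh).
  intros x [s [[a [ab ha]] Fs]]; exists a; split; trivial; now exists s.
- intros a; apply (ideal_sub HR) with (1 := fnull _ (proj2_sig a)).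
  intros x [s [e [fs _]]]; now subst s.
(* The fibres over the values [w b nu] are null and indexed by nested proper segments, so they do
   not cover [X]; an uncovered [x] supplies [{d | B d x}]. The original [B] on [X] is used here, not
   [B2]. *)
- intros s N w; apply NNPP; intros H; apply X_positive.
  apply (ideal_sub HR) with (1 := R_segment s _ (fun b _ => R_segment (N b) _
    (fun nu _ => fiber_null (w b nu)))).
  intros x _; apply NNPP; intros Hx; apply H; exists (fun d => B d x).
  intros b nu bs nuN e; apply Hx; exists b; split; trivial; exists nu; now split.
Qed.

(** * Passage to the restricted ideal, and an atom from a positive fibre *)

Theorem theorem1 (X : Type) (I : pset X -> Prop)
  (HI : is_ideal I) (Hal : atomless I)
  (A : pset X) (HA : ~ I A)
  (D : (pset X -> Prop) -> Prop) (HD : dense_in (restrict I A) D) :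
  card_ge_add I D.
Proof.
destruct HI as [Isub [_ Ipt]]; destruct HD as [HD1 HD2].
assert (sub : forall P Q : pset X, I Q -> (forall x, P x -> Q x) -> I P).
  intros P Q HQ PQ; apply (Isub Q Q P); auto.
apply NNPP; intros Hadd.
destruct (functional_choice (fun (d : {d | D d}) P =>
  ~ restrict I A P /\ proj1_sig d = qclass (restrict I A) P)) as [B HB].
  intros [d Hd]; exact (HD1 d Hd).
(* If the empty set were not in [I], then [I] would have no members and [A] would vacuously be an
   atom. *)
assert (I0 : I (fun _ => False)).
  apply NNPP; intros H; apply (Hal A); split; trivial.
  intros C HC; exfalso; apply H, (sub _ _ HC); tauto.
assert (HR : complete_ideal {d | D d} (restrict I A)).
  split; unfold restrict.
  - apply (sub _ _ I0); tauto.
  - intros P Q HQ PQ; apply (sub _ _ HQ); intros x [Px Ax]; auto.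
  - intros P Q HP HQ; apply (Isub _ _ _ HP HQ); tauto.
  (* Null sets [f d] with positive union, cut down to [A], would witness [card_ge_add] with [D]
     itself as index set. *)
  - intros f Hf; apply NNPP; intros H; apply Hadd.
    exists {d | D d}, (fun d => meet (f d) A), (@proj1_sig _ _); repeat split; trivial.
    + intros H'; apply H, (sub _ _ H'); intros x [[d fd] Ax]; exists d; now split.
    + intros d; exact (proj2_sig d).
    + intros [d Hd] [e He]; simpl; intros de; subst e; f_equal; apply proof_irrelevance.
assert (dense : forall P, ~ restrict I A P ->
          exists d, ~ restrict I A (B d) /\ restrict I A (diff (B d) P)).
  intros P HP; destruct (HD2 P HP) as [d [B' [Hd [dB' HB']]]].
  exists (exist _ d Hd); destruct (HB (exist _ d Hd)) as [Bpos dB]; split; trivial.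
  assert (qclass (restrict I A) (B (exist _ d Hd)) B') as H.
    rewrite <- dB; simpl; rewrite dB'; apply (sub _ _ I0); tauto.
  apply (Isub _ _ _ H HB'); intros x [[Bx nPx] Ax].
  destruct (classic (B' x)); [right | left]; tauto.
destruct (positive_fiber HR) with (3 := dense) as [v Hv].
- intros x; apply (sub _ _ (Ipt x)); tauto.
- intros H; apply HA, (sub _ _ H); auto.
- (* A fiber of x |-> {d | B_d x} is contained in each B_d that it meets, so it is an atom. *)
  set (Z := fun x => (fun d => B d x) = v) in Hv.
  apply (Hal (meet Z A)); split; [exact Hv|].
  intros C HC; destruct (classic (I C)) as [|nC]; [now left | right].
  assert (Cpos : ~ restrict I A (meet C Z)).
    intros H; apply nC, (Isub _ _ _ H HC); intros x Cx.
    destruct (classic (meet Z A x)) as [[Zx Ax]|]; [left | right]; now repeat split.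
  destruct (dense _ Cpos) as [d [Bpos Bd]].
  destruct (positive_inhabited HR (positive_meet HR Bpos Bd)) as [x [Bx [_ Zx]]].
  apply (sub _ _ Bd); intros y [[Zy Ay] nCy]; split; trivial; split; [|now intros [? _]].
  assert (e : (fun d => B d y) = (fun d => B d x)) by now rewrite Zy.
  now rewrite (f_equal (fun h => h d) e).
Qed.
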